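(* Let $W$ be a discrete memoryless channel with finite input alphabet $\mathcal{X}$ and finite output alphabet $\mathcal{Y}$, and let $q:\mathcal{X}\times\mathcal{Y}\to\mathbb{R}$ be a metric for which there exists a finite $B\ge 0$ such that $q(x,y)\le B$ for all $(x,y)\in\mathcal{X}\times\mathcal{Y}$ and $q(x,y)\ge -B$ for all $(x,y)$ with $W(y|x)>0$. (1) Suppose $\eta_n$ (defined in the context) is well defined. Then every sequence of codebooks $\{\mathcal{C}_n\}_{n\in\mathbb{N}}$ (with $\mathcal{C}_n$ of block length $n$) for which $\lim_{n\to\infty}\frac1{\eta_n}P_e(W^n,\mathcal{C}_n,q_n)=0$ satisfies $$R=\limsup_{n\to\infty}\frac1n\log|\mathcal{C}_n|\le C_q^{(\infty)}(W).$$ (2) In particular, if $q$ is a rational metric (all values $q(x,y)$ are rational) and $\lim_{n\to\infty}n\cdot P_e(W^n,\mathcal{C}_n,q_n)=0$, then $R=\limsup_{n\to\infty}\frac1n\log|\mathcal{C}_n|\le C_q^{(\infty)}(W)$.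
   Context: $W(y|x)$ is a conditional p.m.f.; $W^n(y^n|x^n)=\prod_{i=1}^n W(y_i|x_i)$; $q_n(x^n,y^n)=\frac1n\sum_{i=1}^n q(x_i,y_i)$. A codebook $\mathcal{C}_n$ is a list of $|\mathcal{C}_n|$ codewords $x^n(m)\in\mathcal{X}^n$; messages are equiprobable and message $m$ is sent as $x^n(m)$ over $W^n$. The mismatched decoder $q_n$, on output $y^n$, decides on message $i$ iff $q_n(x^n(i),y^n)>q_n(x^n(j),y^n)$ for all $j\neq i$; if no such $i$ exists an error is declared. $P_e(W^n,\mathcal{C}_n,q_n)$ is the resulting average probability of error. $$\eta_n=\min_{(x^n,\tilde x^n,y^n)\in\mathcal{X}^n\times\mathcal{X}^n\times\mathcal{Y}^n:\ q_n(\tilde x^n,y^n)\ne q_n(x^n,y^n)}\left|q_n(\tilde x^n,y^n)-q_n(x^n,y^n)\right|,$$ which is well defined (and strictly positive) when the set of triples over which one minimizes is nonempty (this set is nonempty for one $n$ iff it is nonempty for all $n$). $C_q^{(\infty)}(W)=\limsup_{k\to\infty}C_q^{(k)}(W)$, where $$C_q^{(k)}(W)=\max_{P_{X^k}}\ \min_{P_{\widetilde Y^k|X^k}}\ \frac1k I(X^k;\widetilde Y^k),$$ the max being over distributions $P_{X^k}$ on $\mathcal{X}^k$, with $(X^k,Y^k)\sim P_{X^k}\times W^k$, $(X^k,\widetilde Y^k)\sim P_{X^k}\times P_{\widetilde Y^k|X^k}$, and the min over conditional p.m.f.s $P_{\widetilde Y^k|X^k}$ with $P_{\widetilde Y^k}=P_{Y^k}$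 and $\mathbb{E}(q_k(X^k,\widetilde Y^k))\ge\mathbb{E}(q_k(X^k,Y^k))$. Logarithms are natural. *)

(* Defs.v *)
From HB Require Import structures.
From mathcomp Require Import all_boot all_order all_algebra.
From mathcomp Require Import all_classical all_reals all_analysis.
Import Order.TTheory GRing.Theory Num.Theory.
Import numFieldNormedType.Exports.
Set Implicit Arguments.
Unset Strict Implicit.
Unset Printing Implicit Defensive.
Local Open Scope classical_set_scope.
Local Open Scope ring_scope.

(* Words of length n are finite functions; letters are x i, for i : 'I_n. *)
Notation word X n := {ffun 'I_n -> X} (only parsing).

Section Distributions.
Variables (R : realType) (A B : finType).

Definition is_pmf (p : A -> R) : Prop :=
  (forall a, 0 <= p a) /\ \sum_(a : A) p a = 1.

(* V a b is the conditional probability V(b|a). *)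
Definition is_channel (V : A -> B -> R) : Prop :=
  forall a, (forall b, 0 <= V a b) /\ \sum_(b : B) V a b = 1.

Definition joint (p : A -> R) (V : A -> B -> R) (a : A) (b : B) : R :=
  p a * V a b.

Definition marginal1 (pab : A -> B -> R) (a : A) : R := \sum_(b : B) pab a b.

Definition marginal2 (pab : A -> B -> R) (b : B) : R := \sum_(a : A) pab a b.

Definition expectation2 (pab : A -> B -> R) (f : A -> B -> R) : R :=
  \sum_(a : A) \sum_(b : B) pab a b * f a b.

(* In nats.  The convention 0 ln (0/0) = 0 holds automatically, since the factor
   pab a b vanishes; where it is positive, both marginals are positive. *)
Definition mutual_info (pab : A -> B -> R) : R :=
  \sum_(a : A) \sum_(b : B)
    pab a b * ln (pab a b / (marginal1 pab a * marginal2 pab b)).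

End Distributions.

Section MismatchedDecoding.
Variables (R : realType) (X Y : finType).
Variables (W : X -> Y -> R) (q : X -> Y -> R).

Definition memoryless n (x : word X n) (y : word Y n) : R :=
  \prod_(i < n) W (x i) (y i).

Definition metric n (x : word X n) (y : word Y n) : R :=
  n%:R^-1 * \sum_(i < n) q (x i) (y i).

(* A codebook of block length n is a list of words, possibly with repetitions;
   messages are the positions in that list. *)
Definition codeword n (C : seq (word X n)) (m : 'I_(size C)) : word X n :=
  tnth (in_tuple C) m.

(* At most one message satisfies the condition, so the choice made by [pick]
   is forced; None means that the decoder declares an error. *)
Definition decide n (C : seq (word X n)) (y : word Y n) : option 'I_(size C) :=
  [pick i : 'I_(size C) |
     [forall j : 'I_(size C),
        (j != i) ==> (metric (codeword j) y < metric (codeword i) y)]].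

Definition error_prob n (C : seq (word X n)) : R :=
  (size C)%:R^-1 *
  \sum_(m < size C)
    \sum_(y : word Y n | decide C y != Some m) memoryless (codeword m) y.

Definition metric_gaps n : set R :=
  [set d | exists (x x' : word X n) (y : word Y n),
     metric x' y <> metric x y /\ d = `|metric x' y - metric x y| ].

Definition min_gap_well_defined n : Prop := metric_gaps n !=set0.

(* This is eta_n.  The set metric_gaps n is finite, so the infimum is a minimum
   whenever min_gap_well_defined n holds. *)
Definition min_gap n : R := inf (metric_gaps n).

(* The conditional pmfs V = P_{\tilde Y^k | X^k} admissible in the inner
   minimum of C_q^(k)(W), for the input distribution p = P_{X^k}. *)
Definition admissible k (p : word X k -> R) : set (word X k -> word Y k -> R) :=
  [set V | [/\ is_channel V,
     forall y, marginal2 (joint p V) y =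
               marginal2 (joint p (@memoryless k)) y
   & expectation2 (joint p (@memoryless k)) (@metric k)
       <= expectation2 (joint p V) (@metric k)] ].

(* C_q^(k)(W).  The inner infimum is a minimum (continuous objective on a
   nonempty compact polytope).  The outer supremum is a maximum when X is
   nonempty: the polytope of joint laws varies continuously with p, hence so
   does the inner minimum. *)
Definition Cq_k (k : nat) : \bar R :=
  ereal_sup [set ereal_inf [set (k%:R^-1 * mutual_info (joint p V))%:E
                           | V in admissible p]
            | p in [set p : word X k -> R | is_pmf p]].

Definition Cq_infty : \bar R := limn_esup Cq_k.

Definition code_rate (C : forall n, seq (word X n)) : \bar R :=
  limn_esup (fun n => (n%:R^-1 * ln (size (C n))%:R)%:E).

Definition bounded_metric : Prop :=
  exists B : R, [/\ 0 <= B, (forall x y, q x y <= B)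
                  & forall x y, 0 < W x y -> - B <= q x y].

Definition rational_metric : Prop := forall x y, exists r : rat, q x y = ratr r.

End MismatchedDecoding.

Arguments min_gap_well_defined {R X Y} q n.
Arguments min_gap {R X Y} q n.
Arguments error_prob {R X Y} W q {n} C.
Arguments code_rate R {X} C.

(* Main.v *)
(** Let p be the uniform law on the codewords and V an admissible channel, and
    let g(y) be the metric at y of the decoded word (or the upper bound B when an
    error is declared), so that g(y) - q_n(x,y) >= 0 for every codeword x.  Since V
    preserves the output law and does not decrease the expected metric, the
    expectation of g - q_n under p x V is at most the one under p x W^n, which is
    at most 2 B P_e.  A positive value of g - q_n at a decoded output is at least
    eta_n, so by Markov's inequality x is the decoded word with probability at
    least 1 - eps under p x V, where eps = (1 + 2B/eta_n) P_e.  Under the product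
    of the marginals that event has probability at most 1/|C_n|, since a decoded
    word is never repeated in the codebook.  Hence the mutual information is at
    least (1 - eps) ln |C_n| - 1. *)

Require Import Defs.
From HB Require Import structures.
From mathcomp Require Import all_boot all_order all_algebra.
From mathcomp Require Import all_classical all_reals all_analysis.
From mathcomp Require Import ring lra.
Import Order.TTheory GRing.Theory Num.Theory.
Import numFieldNormedType.Exports.
Set Implicit Arguments.
Unset Strict Implicit.
Unset Printing Implicit Defensive.
Local Open Scope classical_set_scope.
Local Open Scope ring_scope.

(** * Mutual information and the empirical law of a codebook *)

(* A variational lower bound, obtained by summing P ln (Q t / P) <= Q t - P over
   all pairs, where Q is the product of the marginals of P. *)
Lemma mutual_info_ge (R : realType) (A B : finType) (P t : A -> B -> R) :
  (forall a b, 0 <= P a b) -> (forall a b, 0 < t a b) ->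
  expectation2 P (fun a b => ln (t a b)) + \sum_a \sum_b P a b
    - \sum_a \sum_b marginal1 P a * marginal2 P b * t a b
  <= mutual_info P.
Proof.
move=> P0 t0; rewrite /expectation2 /mutual_info -big_split -sumrB /=.
apply: ler_sum => a _; rewrite -big_split -sumrB /=; apply: ler_sum => b _.
have m1 : P a b <= marginal1 P a.
  by rewrite /marginal1 (bigD1 b)//= lerDl sumr_ge0.
have m2 : P a b <= marginal2 P b.
  by rewrite /marginal2 (bigD1 a)//= lerDl sumr_ge0.
have [Pab0|Pab0] := eqVneq (P a b) 0.
  rewrite Pab0 !mul0r !add0r oppr_le0.
  by rewrite !mulr_ge0 ?(ltW (t0 _ _)) // /marginal1 /marginal2 sumr_ge0.
have Pp : 0 < P a b by rewrite lt_neqAle eq_sym Pab0 P0.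
have m1p := lt_le_trans Pp m1; have m2p := lt_le_trans Pp m2.
set Q := marginal1 P a * marginal2 P b.
have Qp : 0 < Q by rewrite mulr_gt0.
have zp : 0 < Q * t a b / P a b by rewrite divr_gt0 // mulr_gt0.
have : ln (1 + (Q * t a b / P a b - 1)) <= Q * t a b / P a b - 1.
  by apply: le_ln1Dx; lra.
rewrite addrCA subrr addr0 => /(ler_wpM2l (ltW Pp)).
have e : ln (Q * t a b / P a b) = ln (t a b) - ln (P a b / Q).
  have -> : Q * t a b / P a b = t a b * (P a b / Q)^-1.
    by field; rewrite ?gt_eqF //= ?Pab0.
  by rewrite lnM ?lnV ?posrE ?invr_gt0 ?divr_gt0.
rewrite e !mulrBr mulr1 [P a b * (_ / P a b)]mulrC divfK //.
lra.
Qed.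

(** Words are weighted by multiplicity, so an average over messages, as in [error_prob], is an
    expectation under this law even when the codebook repeats a word. *)
Definition uniform_law (R : realType) (A : finType) k (x : 'I_k -> A) (a : A) : R :=
  k%:R^-1 * \sum_(m < k) (x m == a)%:R.
Arguments uniform_law R {A k}.

Lemma sum_uniform_law (R : realType) (A : finType) k (x : 'I_k -> A) (F : A -> R) :
  \sum_a uniform_law R x a * F a = k%:R^-1 * \sum_(m < k) F (x m).
Proof.
under eq_bigr do rewrite -mulrA mulr_suml.
rewrite -mulr_sumr exchange_big /=; congr (_ * _); apply: eq_bigr => m _.
rewrite (bigD1 (x m)) //= eqxx mul1r big1 ?addr0 // => a /negPf.
by rewrite eq_sym => ->; rewrite mul0r.
Qed.

Lemma uniform_law_pmf (R : realType) (A : finType) k (x : 'I_k -> A) :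
  (0 < k)%N -> is_pmf (uniform_law R x).
Proof.
move=> k0; split=> [a|].
  by rewrite mulr_ge0 ?invr_ge0 ?ler0n ?sumr_ge0.
under eq_bigr do rewrite -[uniform_law _ _]mulr1.
rewrite (sum_uniform_law x (fun=> 1)) sumr_const card_ord mulVf //.
by rewrite pnatr_eq0 -lt0n.
Qed.

Lemma expectation2_uniform_law (R : realType) (A B : finType) k (x : 'I_k -> A)
    (V F : A -> B -> R) :
  expectation2 (joint (uniform_law R x) V) F =
  k%:R^-1 * \sum_(m < k) \sum_b V (x m) b * F (x m) b.
Proof.
rewrite -(sum_uniform_law x (fun a => \sum_b V a b * F a b)).
apply: eq_bigr => a _; rewrite mulr_sumr; apply: eq_bigr => b _.
by rewrite mulrA.
Qed.

Lemma expectation2_marginal2 (R : realType) (A B : finType) (P : A -> B -> R) (h : B -> R) :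
  expectation2 P (fun=> h) = \sum_b marginal2 P b * h b.
Proof.
rewrite /expectation2 exchange_big /=; apply: eq_bigr => b _.
by rewrite -mulr_suml.
Qed.

Lemma decide_lt (R : realType) (X Y : finType) (q : X -> Y -> R) n
    (C : seq {ffun 'I_n -> X}) (y : {ffun 'I_n -> Y}) m j :
  decide q C y = Some m -> j != m ->
  metric q (codeword j) y < metric q (codeword m) y.
Proof.
by rewrite /decide; case: pickP => // i /forallP H [<-] /(implyP (H j)).
Qed.

(** * Bounds at a fixed block length *)

Section CodebookLaw.
Variables (R : realType) (X Y : finType) (W : X -> Y -> R) (q : X -> Y -> R).
Variables (n : nat) (C : seq {ffun 'I_n -> X}).
Hypotheses (n0 : (0 < n)%N) (C0 : (0 < size C)%N) (hW : is_channel W).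

Let p : {ffun 'I_n -> X} -> R := uniform_law R (@codeword X n C).

(** Words are compared, not messages, since the joint law lives on words; a declared error counts as
    undecided for every [x]. *)
Definition decided (x : {ffun 'I_n -> X}) (y : {ffun 'I_n -> Y}) : bool :=
  if decide q C y is Some m then x == codeword m else false.

Lemma memoryless_ge0 (x : {ffun 'I_n -> X}) (y : {ffun 'I_n -> Y}) :
  0 <= memoryless W x y.
Proof. by apply: prodr_ge0 => i _; exact: (hW _).1. Qed.

Lemma metric_le B (x : {ffun 'I_n -> X}) (y : {ffun 'I_n -> Y}) :
  (forall a b, q a b <= B) -> metric q x y <= B.
Proof.
move=> qB; rewrite /metric mulrC ler_pdivrMr ?ltr0n //.
rewrite mulr_natr -[n in leRHS]card_ord -sumr_const; exact: ler_sum.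
Qed.

Lemma metric_ge B (x : {ffun 'I_n -> X}) (y : {ffun 'I_n -> Y}) :
  (forall a b, 0 < W a b -> - B <= q a b) ->
  0 < memoryless W x y -> - B <= metric q x y.
Proof.
move=> qB W0; rewrite /metric mulrC ler_pdivlMr ?ltr0n //.
rewrite mulr_natr -[n in leLHS]card_ord -sumr_const; apply: ler_sum => i _.
apply: qB; rewrite lt_neqAle (hW _).1 andbT eq_sym; apply/eqP => Wi.
by move: W0; rewrite /memoryless (bigD1 i) //= Wi mul0r ltxx.
Qed.

Lemma error_probE : error_prob W q C =
  (size C)%:R^-1 * \sum_(m < size C) \sum_y
     memoryless W (codeword m) y * (decide q C y != Some m)%:R.
Proof.
congr (_ * _); apply: eq_bigr => m _; rewrite big_mkcond /=.
by apply: eq_bigr => y _; case: ifP => _; rewrite ?mulr1 ?mulr0.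
Qed.

Lemma undecided_prob_le B d V :
  (forall a b, q a b <= B) -> (forall a b, 0 < W a b -> - B <= q a b) ->
  0 <= B -> 0 < d ->
  (forall (x x' : {ffun 'I_n -> X}) (y : {ffun 'I_n -> Y}),
     metric q x y < metric q x' y -> d <= metric q x' y - metric q x y) ->
  @admissible R X Y W q n p V ->
  expectation2 (joint p V) (fun x y => (~~ decided x y)%:R)
  <= (1 + 2 * B / d) * error_prob W q C.
Proof.
move=> qB qB' B0 d0 gap [Vch Vm VE].
pose g y := if decide q C y is Some m then metric q (codeword m) y else B.
(* [F] dominates the indicator of [~~ decided] on codewords; the indicator of [None] is added
   because [g] may equal the metric at a declared error. Only the metric term of [F] depends on [x],
   so both constraints on [V] apply. *)
pose h y := (decide q C y == None)%:R + d^-1 * g y.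
pose F x y := h y - d^-1 * metric q x y.
have EF U : expectation2 (joint p U) F =
    \sum_y marginal2 (joint p U) y * h y
    - d^-1 * expectation2 (joint p U) (@metric R X Y q n).
  rewrite -expectation2_marginal2 /expectation2 mulr_sumr -sumrB.
  apply: eq_bigr => x _; rewrite mulr_sumr -sumrB; apply: eq_bigr => y _.
  rewrite /F; ring.
have le_g (m : 'I_(size C)) y : metric q (codeword m) y <= g y.
  rewrite /g; case E: decide => [j|]; last exact: metric_le.
  have [->//|mj] := eqVneq m j.
  exact/ltW/(decide_lt E mj).
apply: (@le_trans _ _ (expectation2 (joint p V) F)).
  rewrite !expectation2_uniform_law ler_wpM2l ?invr_ge0 //.
  apply: ler_sum => m _; apply: ler_sum => y _.
  rewrite ler_wpM2l ?(Vch _).1 //.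
  have := le_g m y; rewrite /F /h /decided /g.
  case E: decide => [j|] /=; last first.
    move=> le_m; rewrite -addrA -mulrBr lerDl mulr_ge0 ?invr_ge0 ?(ltW d0) //.
    by rewrite subr_ge0.
  rewrite add0r -mulrBr => le_m; case: eqVneq => [_|xj] /=.
    by rewrite mulr_ge0 ?invr_ge0 ?(ltW d0) // subr_ge0.
  rewrite mulrC ler_pdivlMr // mul1r gap //; apply: (decide_lt E).
  by apply: contraNneq xj => ->.
(* Equal output laws give equal terms in [h]; the metric enters negatively, and its expectation is
   larger under [V]. *)
apply: (@le_trans _ _ (expectation2 (joint p (@memoryless R X Y W n)) F)).
  rewrite !EF; under eq_bigr do rewrite Vm.
  by rewrite lerD2l lerN2 ler_wpM2l ?invr_ge0 ?(ltW d0).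
rewrite expectation2_uniform_law error_probE mulrCA ler_wpM2l ?invr_ge0 //.
rewrite mulr_sumr; apply: ler_sum => m _; rewrite mulr_sumr; apply: ler_sum => y _.
(* The lower bound [- B] on the metric holds only at outputs of positive probability. There [F]
   vanishes under correct decoding and is at most [1 + 2 * B / d] otherwise. *)
have := memoryless_ge0 (codeword m) y; rewrite le_eqVlt => /predU1P[<-|Wy].
  by rewrite !mul0r mulr0.
rewrite mulrCA ler_pM2l //.
have [Em|Em] := eqVneq (decide q C y) (Some m).
  by rewrite /F /h /g Em /= add0r subrr mulr0.
have lo := metric_ge qB' Wy.
have up : g y <= B by rewrite /g; case: decide => [j|] //; exact: metric_le.
rewrite /F /h -addrA -mulrBr /= mulr1 lerD //; first by case: (_ == _).
by rewrite mulrC ler_pM2r ?invr_gt0 //; lra.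
Qed.

Lemma mutual_info_uniform_law_ge V : is_channel V ->
  (1 - expectation2 (joint p V) (fun x y => (~~ decided x y)%:R))
    * ln (size C)%:R - 1 <= mutual_info (joint p V).
Proof.
move=> Vch; set M : R := (size C)%:R.
have M0 : 0 < M by rewrite ltr0n.
have [p0 p1] : is_pmf p := uniform_law_pmf R _ C0.
have P0 x y : 0 <= joint p V x y by rewrite mulr_ge0 ?p0 ?(Vch _).1.
(* The expected logarithm of [t] is the probability of [decided] times [ln M]. Under the product law
   [t] has mean at most 2: 1 from the constant, at most 1 from the decided word. *)
pose t x y : R := if decided x y then M else 1.
have t0 x y : 0 < t x y by rewrite /t; case: ifP.
apply: le_trans (mutual_info_ge P0 t0).
have m1 x : marginal1 (joint p V) x = p x.
  by rewrite /marginal1 -mulr_sumr (Vch x).2 mulr1.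
have P1 : \sum_x \sum_y joint p V x y = 1.
  by rewrite -p1; apply: eq_bigr => x _; exact: m1.
have -> : expectation2 (joint p V) (fun x y => ln (t x y)) =
    (1 - expectation2 (joint p V) (fun x y => (~~ decided x y)%:R)) * ln M.
  rewrite -{1}P1 /expectation2 -sumrB mulr_suml; apply: eq_bigr => x _.
  rewrite -sumrB mulr_suml; apply: eq_bigr => y _.
  by rewrite /t; case: decided; rewrite /= ?ln1; ring.
rewrite P1 -addrA lerD2l.
suff : \sum_x \sum_y marginal1 (joint p V) x * marginal2 (joint p V) y * t x y <= 2.
  by lra.
rewrite exchange_big /=.
have m2 : \sum_y marginal2 (joint p V) y = 1 by rewrite -P1 exchange_big.
have m20 y : 0 <= marginal2 (joint p V) y by rewrite sumr_ge0.
rewrite -[2]mulr1 -{2}m2 mulr_sumr; apply: ler_sum => y _.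
under eq_bigr do rewrite m1 mulrAC.
rewrite -mulr_suml ler_wpM2r //.
apply: (@le_trans _ _ (\sum_x (p x + (decided x y)%:R * (p x * M)))).
  apply: ler_sum => x _; rewrite /t; case: decided; last by rewrite mul0r mulr1 addr0.
  by rewrite mul1r lerDr.
rewrite big_split /= p1 [leRHS](_ : 2 = 1 + 1) // lerD2l.
rewrite /decided; case E: decide => [m|]; last first.
  by rewrite big1 // => x _; rewrite mul0r.
rewrite (bigD1 (codeword m)) //= eqxx mul1r big1 ?addr0; last first.
  by move=> x /negPf ->; rewrite mul0r.
(* Another message with the word of [m] would tie with it in the metric, so this word has
   multiplicity one and [p (codeword m) * M = 1]. *)
rewrite /p /uniform_law (bigD1 m) //= eqxx big1 ?addr0 ?mulr1 ?mulVf ?gt_eqF //.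
move=> j /(decide_lt E); case: eqVneq => // ->.
by rewrite ltxx.
Qed.

(** The outer supremum is tested at the single law [p]; the two preceding bounds hold for every
    admissible [V]. *)
Lemma Cq_k_ge B d :
  (forall a b, q a b <= B) -> (forall a b, 0 < W a b -> - B <= q a b) ->
  0 <= B -> 0 < d ->
  (forall (x x' : {ffun 'I_n -> X}) (y : {ffun 'I_n -> Y}),
     metric q x y < metric q x' y -> d <= metric q x' y - metric q x y) ->
  (((1 - (1 + 2 * B / d) * error_prob W q C) * (n%:R^-1 * ln (size C)%:R)
    - n%:R^-1)%:E <= Cq_k W q n)%E.
Proof.
move=> qB qB' B0 d0 gap.
apply: (@le_trans _ _ (ereal_inf [set (n%:R^-1 * mutual_info (joint p V))%:E
                           | V in @admissible R X Y W q n p])); last first.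
  by apply: ereal_sup_ubound; exists p => //; exact: uniform_law_pmf.
apply: le_ereal_inf_tmp => _ [V VA <-].
rewrite lee_fin mulrCA -[X in _ - X]mulr1 -mulrBr ler_wpM2l ?invr_ge0 //.
apply: le_trans (mutual_info_uniform_law_ge _); last by case: VA.
rewrite lerD2r ler_wpM2r ?ln_ge0 ?ler1n // lerD2l lerN2.
exact: undecided_prob_le.
Qed.

End CodebookLaw.

(** * Passage to the limit superior *)

(* No bound on [a] is assumed: a rate could a priori be infinite. *)
Lemma limn_esup_le_perturb (R : realType) (a e f : nat -> R) (c : nat -> \bar R) :
  e @ \oo --> (0 : R) -> f @ \oo --> (0 : R) ->
  (\forall n \near \oo, ((1 - e n) * a n - f n)%:E <= c n)%E ->
  (limn_esup (fun n => (a n)%:E) <= limn_esup c)%E.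
Proof.
move=> e0 f0 ac; rewrite leNgt; apply/negP => /ereal_inf_lt[_ [A Aoo <-]].
have cA n : A n -> (c n <= ereal_sup (c @` A))%E.
  by move=> An; apply: ereal_sup_ubound; exists n.
case: (ereal_sup _) cA => [r| |] cA; last 2 first.
- by rewrite ltNge leey.
- have [n [An]] : exists n, A n /\ (((1 - e n) * a n - f n)%:E <= c n)%E.
    have [n [An acn]] := filter_ex (filterI Aoo ac); by exists n.
  by move=> acn _; have := le_trans acn (cA _ An); rewrite leeNy_eq.
apply/negP; rewrite -leNgt; apply/lee_addgt0Pr => eps eps0.
(* Since [(1 - e n) * a n <= r + f n], the bound [a n <= r + eps] follows once
   [f n + e n * (r + eps) <= eps] and [e n < 1]. *)
have small : (fun n => f n + e n * (r + eps)) @ \oo --> (0 : R).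
  rewrite (_ : 0 = 0 + 0 * (r + eps)); last by rewrite mul0r addr0.
  by apply: cvgD => //; exact: cvgMr_tmp.
have near_le : \forall n \near \oo, a n <= r + eps.
  near=> n.
  have : f n + e n * (r + eps) <= eps by near: n; exact: cvgr_le small _ eps0.
  have : e n < 1 by near: n; exact: cvgr_lt e0 _ ltr01.
  have : (1 - e n) * a n - f n <= r.
    rewrite -lee_fin; apply: (@le_trans _ _ (c n)); first by near: n.
    by apply: cA; near: n.
  move=> h1 e1 h2; rewrite -(@ler_pM2l _ (1 - e n)) ?subr_gt0 //.
  lra.
apply: (@le_trans _ _ (ereal_sup [set (a n)%:E | n in [set n | a n <= r + eps]])).
  by apply: ereal_inf_lbound; exists [set n | a n <= r + eps].
by apply: ge_ereal_sup => _ [n an <-]; rewrite lee_fin.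
Unshelve. all: by end_near. Qed.

Section Converse.
Variables (R : realType) (X Y : finType) (W : X -> Y -> R) (q : X -> Y -> R).
Hypothesis hW : is_channel W.

Lemma error_prob_ge0 n (C : seq {ffun 'I_n -> X}) : 0 <= error_prob W q C.
Proof.
rewrite mulr_ge0 ?invr_ge0 // sumr_ge0 // => m _; rewrite sumr_ge0 // => y _.
exact: memoryless_ge0.
Qed.

(** The upper bound [K] makes the error probability itself vanish, as the summand 1 in
    [1 + 2 * B / d n] requires. Taking any lower bound [d] on the gaps also covers rational metrics
    whose set of gaps is empty. *)
Lemma code_rate_le (d : nat -> R) (K : R) (C : forall n, seq {ffun 'I_n -> X}) :
  bounded_metric W q ->
  (forall n, (0 < n)%N -> 0 < d n <= K) ->
  (forall n (x x' : {ffun 'I_n -> X}) (y : {ffun 'I_n -> Y}), (0 < n)%N ->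
     metric q x y < metric q x' y -> d n <= metric q x' y - metric q x y) ->
  (forall n, (0 < size (C n))%N) ->
  (fun n => (d n)^-1 * error_prob W q (C n)) @ \oo --> (0 : R) ->
  (code_rate R C <= Cq_infty W q)%E.
Proof.
move=> [B [B0 qB qB']] dK gap C0 Pd.
have P0 : (fun n => error_prob W q (C n)) @ \oo --> (0 : R).
  apply: (@squeeze_cvgr _ _ _ _ (fun=> 0)
    (fun n => K * ((d n)^-1 * error_prob W q (C n)))).
  - near=> n; rewrite error_prob_ge0 /=.
    have /dK/andP[dn0 dnK] : (0 < n)%N by near: n; exact: nbhs_infty_gt.
    rewrite mulrA ler_peMl ?error_prob_ge0 //.
    by rewrite ler_pdivlMr // mul1r.
  - exact: cvg_cst.
  - by rewrite -(mulr0 K); exact: cvgMl_tmp.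
apply: (@limn_esup_le_perturb _ _
  (fun n => (1 + 2 * B / d n) * error_prob W q (C n)) (fun n => n%:R^-1)).
- have -> : (fun n => (1 + 2 * B / d n) * error_prob W q (C n)) =
      (fun n => error_prob W q (C n) + 2 * B * ((d n)^-1 * error_prob W q (C n))).
    by apply/funext => n; ring.
  rewrite (_ : 0 = 0 + 2 * B * 0); last by rewrite mulr0 addr0.
  by apply: cvgD => //; exact: cvgMl_tmp.
- by rewrite -cvg_shiftS; exact: cvg_harmonic.
- near=> n; have n0 : (0 < n)%N by near: n; exact: nbhs_infty_gt.
  have /andP[dn0 _] := dK _ n0.
  by apply: Cq_k_ge => // x x' y; exact: gap.
Unshelve. all: by end_near. Qed.

(** * Metric gaps, in general and for rational metrics *)

Lemma min_gap_le n (x x' : {ffun 'I_n -> X}) (y : {ffun 'I_n -> Y}) :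
  metric q x' y <> metric q x y -> min_gap q n <= `|metric q x' y - metric q x y|.
Proof.
move=> ne; apply: ge_inf; last by exists x, x', y.
by exists 0 => _ [? [? [? [_ ->]]]].
Qed.

(** There are finitely many triples, so the gap at a minimizing one bounds all the others. *)
Lemma min_gap_gt0 n : min_gap_well_defined q n -> 0 < min_gap q n.
Proof.
move=> nz; have [_ [x [x' [y [/eqP ne _]]]]] := nz.
pose P (t : {ffun 'I_n -> X} * {ffun 'I_n -> X} * {ffun 'I_n -> Y}) :=
  metric q t.1.2 t.2 != metric q t.1.1 t.2.
pose F (t : {ffun 'I_n -> X} * {ffun 'I_n -> X} * {ffun 'I_n -> Y}) :=
  `|metric q t.1.2 t.2 - metric q t.1.1 t.2|.
have [t Pt tmin] := @arg_minP _ _ _ (x, x', y) P F ne.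
apply: (@lt_le_trans _ _ (F t)); first by rewrite normr_gt0 subr_eq0.
apply: lb_le_inf => // _ [z [z' [w [/eqP zw ->]]]].
exact: (tmin (z, z', w)).
Qed.

Lemma metric_const n (x : X) (y : Y) : (0 < n)%N ->
  @metric R X Y q n [ffun=> x] [ffun=> y] = q x y.
Proof.
move=> n0; rewrite /metric; under eq_bigr do rewrite !ffunE.
by rewrite sumr_const card_ord -[q x y *+ n]mulr_natl mulKf // pnatr_eq0 -lt0n.
Qed.

(** Constant words reproduce a single-letter gap at every block length, so one bound serves all
    [n]. *)
Lemma min_gap_bounded : min_gap_well_defined q 1 ->
  exists K, forall n, (0 < n)%N -> min_gap q n <= K.
Proof.
move=> [_ [x [x' [y [ne _]]]]].
have cst (T : Type) (z : {ffun 'I_1 -> T}) : z = [ffun=> z ord0].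
  by apply/ffunP => i; rewrite ffunE ord1.
move: ne; rewrite (cst _ x) (cst _ x') (cst _ y) !metric_const // => ne.
exists `|q (x' ord0) (y ord0) - q (x ord0) (y ord0)| => n n0.
by rewrite -!(@metric_const n) // min_gap_le // !metric_const.
Qed.

Lemma rational_metric_denominator : rational_metric q ->
  exists2 D : nat, (0 < D)%N & forall x y, D%:R * q x y \is a Num.int.
Proof.
move=> qrat.
have /choice[r rP] (xy : X * Y) : exists r : rat, q xy.1 xy.2 = ratr r by exact: qrat.
pose den xy : nat := `|denq (r xy)|%N.
exists (\prod_xy den xy)%N; first by rewrite prodn_gt0 // => xy; rewrite absz_gt0 denq_eq0.
move=> x y; rewrite (bigD1 (x, y)) //= natrM mulrAC rpredM //; last exact: natr_int.
rewrite (rP (x, y)) /den /ratr.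
have -> : `|denq (r (x, y))|%N%:R = (denq (r (x, y)))%:~R :> R.
  by rewrite natr_absz gtr0_norm // denq_gt0.
by rewrite mulrC divfK ?intr_int // intr_eq0 denq_eq0.
Qed.

(** Scaling by [D * n] makes all metrics integers, and a positive integer is at least 1. *)
Lemma rational_metric_gap (D n : nat) (x x' : {ffun 'I_n -> X}) (y : {ffun 'I_n -> Y}) :
  (0 < D)%N -> (0 < n)%N -> (forall a b, D%:R * q a b \is a Num.int) ->
  metric q x y < metric q x' y ->
  (D%:R * n%:R)^-1 <= metric q x' y - metric q x y.
Proof.
move=> D0 n0 Dq lt_xx'.
have Dn0 : 0 < D%:R * n%:R :> R by rewrite mulr_gt0 ?ltr0n.
have metric_int z : D%:R * n%:R * metric q z y \is a Num.int.
  rewrite /metric mulrA mulfK ?pnatr_eq0 -?lt0n //.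
  by rewrite mulr_sumr rpred_sum.
rewrite -(ler_pM2l Dn0) mulfV ?gt_eqF //.
have /intrP[k kE] : D%:R * n%:R * (metric q x' y - metric q x y) \is a Num.int.
  by rewrite mulrBr rpredB.
have : 0 < D%:R * n%:R * (metric q x' y - metric q x y).
  by rewrite mulr_gt0 // subr_gt0.
by rewrite kE ltr0z ler1z gtz0_ge1.
Qed.

End Converse.

Theorem theorem3 (R : realType) (X Y : finType) (W : X -> Y -> R)
    (q : X -> Y -> R) (hW : is_channel W) (hq : bounded_metric W q) :
  ((forall n : nat, (0 < n)%N -> min_gap_well_defined q n) ->
   forall C : forall n : nat, seq {ffun 'I_n -> X},
     (forall n : nat, (0 < size (C n))%N) ->
     (fun n : nat => (min_gap q n)^-1 * error_prob W q (C n)) @ \oo --> (0 : R) ->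
     (code_rate R C <= Cq_infty W q)%E)
  /\
  (rational_metric q ->
   forall C : forall n : nat, seq {ffun 'I_n -> X},
     (forall n : nat, (0 < size (C n))%N) ->
     (fun n : nat => n%:R * error_prob W q (C n)) @ \oo --> (0 : R) ->
     (code_rate R C <= Cq_infty W q)%E).
Proof.
split=> [gaps C C0 Pe|qrat C C0 Pe].
  have [K minK] := min_gap_bounded (gaps _ (ltnSn 0)).
  apply: (code_rate_le hW hq _ _ C0 Pe) => [n n0|n x x' y n0 lt_xx'].
    by apply/andP; split; [apply: min_gap_gt0; exact: gaps | exact: minK].
  have := lt_xx'; rewrite -subr_gt0 => /gtr0_norm <-.
  by apply: min_gap_le; apply/eqP; rewrite gt_eqF.
have [D D0 Dq] := rational_metric_denominator qrat.
(* With this [d], the ratio of error probability to gap is [D] times the sequence assumed to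
   vanish. *)
apply: (@code_rate_le _ _ _ W q hW (fun n => (D%:R * n%:R)^-1) 1) => // [n n0|n x x' y n0|].
- rewrite invr_gt0 mulr_gt0 ?ltr0n //= invf_le1 ?mulr_gt0 ?ltr0n //.
  by rewrite -natrM ler1n muln_gt0 D0.
- exact: rational_metric_gap.
- under eq_fun do rewrite invrK -mulrA.
  by rewrite -(mulr0 D%:R); exact: cvgMl_tmp.
Qed.
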